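(* Let $E$ be a UMD Banach space, let $p\in(1,\infty)$ and let $k\ge1$ be an integer. Let $F\in L^p(\Omega;\gamma^k(H,E))$ be such that $\langle F,x^*\rangle\in\mathrm{Dom}_{1,\mathbb R}(\delta^k)$ for all $x^*\in E^*$. If there exists $\xi\in L^p(\Omega;E)$ such that for all $x^*\in E^*$ $$\delta^k\langle F,x^*\rangle=\langle\xi,x^*\rangle,$$ then $F\in\mathrm{Dom}_{p,E}(\delta^k)$ and $\delta^kF=\xi$.
   Context: All vector spaces are real. $H$ is a separable Hilbert space, $(\Omega,\mathscr F,\mathbb P)$ is a probability space, and $W=\{W(h):h\in H\}$ is an isonormal Gaussian process on it: a (jointly) centered Gaussian family with $\mathbb E[W(h_1)W(h_2)]=\langle h_1,h_2\rangle$; $\mathscr F$ is generated by $W$. UMD: a Banach space $E$ is UMD if for some (equivalently all) $p\in(1,\infty)$ there is a constant $\beta$ such that $(\mathbb E\|\sum_{n=1}^N\varepsilon_nd_n\|^p)^{1/p}\le\beta(\mathbb E\|\sum_{n=1}^N d_n\|^p)^{1/p}$ for every $N\geq 1$, every $E$-valued $L^p$-martingale difference sequence $(d_n)_{n=1}^N$ and all signs $\varepsilon_n\in\{-1,1\}$. $\gamma$-radonifying operators: for $h\in H$, $x\in E$, $h\otimes x$ is the operator $h'\mapsto\langle h,h'\rangle x$. For orthonormal $h_1,\dots,h_n$ put $\|\sum_j h_j\otimes x_j\|_{\gamma(H,E)}=(\mathbb E\|\sum_j\gamma_jx_j\|^2)^{1/2}$ with $(\gamma_j)$ independent standard Gaussians;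 $\gamma(H,E)$ is the closure of the finite rank operators in this norm. $\gamma^1(H,E)=\gamma(H,E)$, $\gamma^n(H,E)=\gamma(H,\gamma^{n-1}(H,E))$; $\gamma(H,\mathbb R)=H$. For $R\in\gamma^k(H,E)$ and $x^*\in E^*$, $\langle R,x^*\rangle\in\gamma^k(H,\mathbb R)$ is defined recursively by $\langle R,x^*\rangle h=\langle Rh,x^*\rangle$; for random variables this is pointwise in $\Omega$. Trace pairing: for $R\in\gamma(H,E)$, $S\in\gamma(H,E^* )$, $\langle R,S\rangle_{\mathrm{Tr}}=\sum_{n\ge1}\langle Rh_n,Sh_n\rangle$ for an orthonormal basis $(h_n)$ of $H$. For $k\ge2$ and $R\in\gamma^k(H,E)$, $S\in\gamma^k(H,E^* )$, recursively $\langle R,S\rangle_{\mathrm{Tr}}=\sum_{n\ge1}\langle Rh_n,Sh_n\rangle_{\mathrm{Tr}}$. Malliavin derivative on smooth variables: $\mathscr S\otimes E$ is the linear span of the random variables $G=f(W(h_1),\dots,W(h_n))\otimes x$ with $f\in C_b^\infty(\mathbb R^n)$, $h_i\in H$, $x\in E$, and $DG=\sum_{i=1}^n\partial_if(W(h_1),\dots,W(h_n))\otimes(h_i\otimes x)$, with values in $\gamma(H,E)$; $D^k$ denotes the iterate, with values in $\gamma^k(H,E)$. Divergence operator: for $p\in[1,\infty)$, $\mathrm{Dom}_{p,E}(\delta^k)$ is the set of $\zeta\in L^p(\Omega;\gamma^k(H,E))$ for which there is $Y\in L^p(\Omega;E)$ such that $\mathbb E\langle\zeta,D^kG\rangle_{\mathrm{Tr}}=\mathbb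 E\langle Y,G\rangle_{E,E^*}$ for all $G\in\mathscr S\otimes E^*$; then $Y$ is unique and $\delta^k(\zeta):=Y$. For $k=1$ this is the divergence operator $\delta$. *)

(* Defs.v *)
From Stdlib Require List.
From mathcomp Require Import all_boot all_order all_algebra.
From mathcomp Require Import all_classical all_reals all_analysis.

Set Implicit Arguments.
Unset Strict Implicit.
Unset Printing Implicit Defensive.

Import Order.TTheory GRing.Theory Num.Theory.
Import numFieldNormedType.Exports.

Local Open Scope classical_set_scope.
Local Open Scope ring_scope.

(** * Banach spaces given by extended norms

  The spaces gamma^k(H, E) consist of operators H -> (H -> ... (H -> E)).  We
  keep the ambient vector space of all maps as carrier, and let the norm take
  the value +oo outside the space: the actual normed space is [bspace X]. *)

Record enormed (R : realType) := ENormed {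
  ecar :> lmodType R;
  enorm : ecar -> \bar R }.

Arguments enorm {R e} x.

Definition bspace (R : realType) (X : enormed R) : set X :=
  [set x | (enorm x < +oo)%E].

Arguments bspace {R} X _.

Definition of_normed (R : realType) (E : normedModType R) : enormed R :=
  @ENormed R E (fun x => (`|x|)%:E).

Definition scalars (R : realType) : enormed R := of_normed R^o.

(* The operator norm; it is +oo when f is not linear or not bounded (the
   infimum of the empty set), so that [bspace (topdual E)] is E^*. *)
Definition topdual (R : realType) (E : normedModType R) : enormed R :=
  @ENormed R (E -> R^o) (fun f => ereal_inf
    [set M%:E | M in [set M : R | 0 <= M /\
       (forall (a : R) (x y : E), f (a *: x + y) = a *: f x + f y) /\
       forall x : E, `|f x| <= M * `|x| ]]).

(** * Strong measurability, Bochner integral and L^p *)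

Record simple_fun (T : Type) (R : realType) (X : enormed R) := SimpleFun {
  sf_size : nat;
  sf_set : 'I_sf_size -> set T;
  sf_val : 'I_sf_size -> X }.

Arguments sf_set {T R X} s i.
Arguments sf_val {T R X} s i.

Section bochner.
Context d (T : measurableType d) (R : realType) (P : probability T R).
Context (X : enormed R).

Definition sf_eval (s : simple_fun T X) (w : T) : X :=
  \sum_i (\1_(sf_set s i) w : R) *: sf_val s i.

Definition sf_integral (s : simple_fun T X) : X :=
  \sum_i fine (P (sf_set s i)) *: sf_val s i.

Definition simple_in (G : set_system T) (s : simple_fun T X) : Prop :=
  forall i, G (sf_set s i) /\ bspace X (sf_val s i).

(* Elements of L^p are represented by everywhere defined strongly measurable
   functions (pointwise limits of simple functions), which every class has. *)
Definition strongly_measurable (G : set_system T) (f : T -> X) : Prop :=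
  exists2 s : nat -> simple_fun T X, (forall n, simple_in G (s n)) &
    forall w, enorm (f w - sf_eval (s n) w) @[n --> \oo] --> 0%E.

Definition Lp_norm (p : R) (f : T -> X) : \bar R :=
  ('N[P]_p%:E[enorm \o f])%E.

Definition Lp (p : R) (f : T -> X) : Prop :=
  [/\ forall w, bspace X (f w), strongly_measurable measurable f &
      (Lp_norm p f < +oo)%E].

Definition bochner_integral (f : T -> X) (v : X) : Prop :=
  exists s : nat -> simple_fun T X,
  [/\ forall n, simple_in measurable (s n),
      (\int[P]_w enorm (f w - sf_eval (s n) w))%E @[n --> \oo] --> 0%E &
      enorm (sf_integral (s n) - v) @[n --> \oo] --> 0%E].

(* g is a version of the conditional expectation of f given G *)
Definition cond_expectation (G : set_system T) (f g : T -> X) : Prop :=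
  strongly_measurable G g /\
  forall A, G A -> exists v,
    bochner_integral (fun w => (\1_A w : R) *: f w) v /\
    bochner_integral (fun w => (\1_A w : R) *: g w) v.

Definition filtration (F : nat -> set_system T) : Prop :=
  [/\ forall n, sigma_algebra setT (F n), forall n, F n `<=` measurable &
      forall n, F n `<=` F n.+1].

(* L^p-martingale difference sequence dd 0, ..., dd (N - 1) *)
Definition martingale_difference (p : R) (N : nat) (F : nat -> set_system T)
    (dd : nat -> T -> X) : Prop :=
  [/\ filtration F,
      forall n, (n < N)%N -> strongly_measurable (F n) (dd n) /\ Lp p (dd n) &
      forall n, (n.+1 < N)%N -> cond_expectation (F n) (dd n.+1) (cst 0)].

End bochner.

Definition UMD (R : realType) (E : completeNormedModType R) : Prop :=
  exists p : R, 1 < p /\ exists beta : R,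
  forall (d : measure_display) (T : measurableType d) (P : probability T R)
    (N : nat) (F : nat -> set_system T) (dd : nat -> T -> of_normed E)
    (eps : nat -> R),
  (0 < N)%N -> martingale_difference P p N F dd ->
  (forall n, eps n = 1 \/ eps n = -1) ->
  (Lp_norm P p (fun w => \sum_(n < N) eps n *: dd n w)%R <=
   beta%:E * Lp_norm P p (fun w => \sum_(n < N) dd n w)%R)%E.

(** * Hilbert space and isonormal process *)

Section hilbert.
Context (R : realType) (H : completeNormedModType R) (ip : H -> H -> R).

Definition inner_product : Prop :=
  [/\ forall a x y z, ip (a *: x + y) z = a * ip x z + ip y z,
      forall x y, ip x y = ip y x &
      forall x, ip x x = `|x| ^+ 2].

Definition separable : Prop := exists2 D : set H, countable D & dense D.

Definition orthonormal_family n (h : 'I_n -> H) : Prop :=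
  forall i j, ip (h i) (h j) = (i == j)%:R.

(* An orthonormal basis, possibly padded with zero vectors so that it is
   always indexed by nat, also when H is finite dimensional. *)
Definition orthonormal_basis (e : nat -> H) : Prop :=
  [/\ forall i j, i != j -> ip (e i) (e j) = 0,
      forall i, e i = 0 \/ `|e i| = 1 &
      forall h, \sum_(i < n) ip (e i) h *: e i @[n --> \oo] --> h].

Context d (T : measurableType d) (P : probability T R).

(* The degenerate law needs a separate clause, because [normal_prob m 0] is
   not a Dirac mass in the library. *)
Definition centered_gaussian (X : T -> R) : Prop :=
  {ae P, forall w, X w = 0} \/
  exists2 s : R, 0 < s &
    forall B, measurable B -> P (X @^-1` B) = normal_prob 0 s B.

Definition isonormal (W : H -> {RV P >-> R}) : Prop :=
  (forall n (h : 'I_n -> H) (a : 'I_n -> R),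
     centered_gaussian (fun w => \sum_i a i * W (h i) w)) /\
  (forall h1 h2, ('E_P[fun w => (W h1 w * W h2 w)%R] = (ip h1 h2)%:E)%E).

Definition generated_by (W : H -> {RV P >-> R}) : Prop :=
  (@measurable _ T) =
  <<s [set A | exists h B, measurable B /\ A = W h @^-1` B] >>.

End hilbert.

(** * gamma-radonifying operators *)

(* Expectation of f (gamma_0, ..., gamma_(n-1)) for independent standard
   Gaussians, as an iterated integral against their product law. *)
Fixpoint gaussian_expectation (R : realType) (n : nat) :
    (seq R -> \bar R) -> \bar R :=
  match n with
  | 0 => fun f => f [::]
  | n.+1 => fun f =>
      (\int[normal_prob 0 1]_t gaussian_expectation n (fun s => f (t :: s)))%E
  end.

Section gamma.
Context (R : realType) (H : completeNormedModType R) (ip : H -> H -> R).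

Section one_step.
Context (X : enormed R).

Definition tensor (h : H) (x : X) : H -> X := fun h' => ip h h' *: x.

(* r is the gamma-norm of the finite rank operator S, computed from some
   representation of S with an orthonormal family *)
Definition finite_rank_norm (S : H -> X) (r : \bar R) : Prop :=
  exists n (h : 'I_n -> H) (x : 'I_n -> X),
  [/\ orthonormal_family ip h, forall i, bspace X (x i),
      S = (fun h' => \sum_i tensor (h i) (x i) h') &
      r = (gaussian_expectation n
             (fun s => enorm (\sum_(i < n) s`_i *: x i)%R ^+ 2) `^ 2^-1)%E].

(* The closure of the finite rank operators: S is the pointwise limit of a
   sequence of finite rank operators that is Cauchy in the gamma-norm, and r is
   the limit of the gamma-norms. *)
Definition gamma_limit_norm (S : H -> X) (r : \bar R) : Prop :=
  exists (S_ : nat -> H -> X) (r_ : nat -> \bar R),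
  [/\ forall n, finite_rank_norm (S_ n) (r_ n),
      forall e : R, 0 < e -> exists N, forall m n, (N <= m)%N -> (N <= n)%N ->
        exists2 r' : \bar R,
          finite_rank_norm (fun h => S_ m h - S_ n h) r' & (r' < e%:E)%E,
      forall h, enorm (S h - S_ n h) @[n --> \oo] --> 0%E &
      r_ n @[n --> \oo] --> r].

(* [gamma_limit_norm S] holds of exactly one number if S is in gamma(H, X), and
   of none otherwise; in the latter case the infimum is +oo. *)
Definition gamma : enormed R :=
  @ENormed R (H -> X) (fun S => ereal_inf [set r | gamma_limit_norm S r]).

End one_step.

Fixpoint gammaN (k : nat) (X : enormed R) : enormed R :=
  if k is k'.+1 then gamma (gammaN k' X) else X.

Section pairings.
Context (E : normedModType R).

(* <S, x^*>, an element of gamma^k(H, R), regarded as a space of operators *)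
Fixpoint pairing (k : nat) (x' : topdual E) :
    gammaN k (of_normed E) -> gammaN k (scalars R) :=
  match k with
  | 0 => fun x => x' x
  | k'.+1 => fun S h => pairing x' (S h)
  end.

(* [limn] is total; the series converges for S and U in the gamma-spaces. *)
Fixpoint trace_pairing (e : nat -> H) (k : nat) :
    gammaN k (of_normed E) -> gammaN k (topdual E) -> R :=
  match k with
  | 0 => fun x x' => x' x
  | k'.+1 => fun S U =>
      limn (fun n => \sum_(i < n) trace_pairing e (S (e i)) (U (e i)))
  end.

End pairings.
End gamma.

(** * Malliavin derivative and divergence *)

Section smooth_functions.
Context (R : realType) (n : nat).

Definition partial (i : 'I_n) (f : 'rV[R]_n -> R^o) : 'rV[R]_n -> R^o :=
  fun x => 'D_(delta_mx 0 i) f x.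

Definition Cb_infty (f : 'rV[R]_n -> R^o) : Prop :=
  forall s : seq 'I_n, let g := foldr partial f s in
  [/\ continuous g, forall x i, derivable g x (delta_mx 0 i) &
      exists M : R, forall x, `|g x| <= M].

End smooth_functions.

(* the random variable f (W h_1, ..., W h_n) ⊗ x *)
Record cylinder (R : realType) (H : completeNormedModType R) (X : enormed R) :=
  Cylinder {
    cyl_size : nat;
    cyl_fun : 'rV[R]_cyl_size -> R^o;
    cyl_dir : 'I_cyl_size -> H;
    cyl_val : X }.

Arguments cyl_fun {R H X} g x : rename.
Arguments cyl_dir {R H X} g i : rename.

Section malliavin.
Context (R : realType) (H : completeNormedModType R) (ip : H -> H -> R).
Context d (T : measurableType d) (P : probability T R).
Context (W : H -> {RV P >-> R}).

Section smooth_variables.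
Context (X : enormed R).

Definition cyl_eval (g : cylinder H X) (w : T) : X :=
  cyl_fun g (\row_i W (cyl_dir g i) w) *: cyl_val g.

Definition cyl_smooth (g : cylinder H X) : Prop :=
  Cb_infty (cyl_fun g) /\ bspace X (cyl_val g).

(* An element of the span of the smooth variables is represented by a list of
   cylinders, whose sum it is. *)
Definition smooth_eval (G : seq (cylinder H X)) (w : T) : X :=
  \sum_(g <- G) cyl_eval g w.

Definition smooth (G : seq (cylinder H X)) : Prop := List.Forall cyl_smooth G.

Definition cyl_D (g : cylinder H X) : seq (cylinder H (gamma ip X)) :=
  [seq Cylinder (partial i (cyl_fun g)) (cyl_dir g)
     (tensor ip (cyl_dir g i) (cyl_val g) : gamma ip X)
  | i <- enum 'I_(cyl_size g)].

Definition malliavin_D (G : seq (cylinder H X)) :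
  seq (cylinder H (gamma ip X)) := flatten [seq cyl_D g | g <- G].

End smooth_variables.

Fixpoint malliavin_Dk (k : nat) (X : enormed R) (G : seq (cylinder H X)) :
    seq (cylinder H (gammaN ip k X)) :=
  match k with
  | 0 => G
  | k'.+1 => malliavin_D (malliavin_Dk k' G)
  end.

Section divergence.
Context (e : nat -> H) (E : completeNormedModType R).

(* Y = delta^k zeta, for zeta in L^p.  The random variable D^k G depends only on the
   random variable G, so G may range over representations.
   There is at most one such Y up to P-null sets, as the sigma-algebra is
   generated by W: the relation is the graph of delta^k. *)
Definition is_divergence (p : R) (k : nat)
    (zeta : T -> gammaN ip k (of_normed E)) (Y : T -> of_normed E) : Prop :=
  Lp P p Y /\
  forall G : seq (cylinder H (topdual E)), smooth G ->
    ('E_P[fun w =>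
       trace_pairing e (zeta w) (smooth_eval (malliavin_Dk k G) w)] =
     'E_P[fun w => smooth_eval G w (Y w)])%E.

Definition divergence_domain (p : R) (k : nat)
    (zeta : T -> gammaN ip k (of_normed E)) : Prop :=
  Lp P p zeta /\ exists Y, is_divergence p zeta Y.

End divergence.
End malliavin.

(* Main.v *)
(** Proof idea.  For a single cylinder [f (W h_1, ..., W h_n) ⊗ x'] the identity
  [E <F, D^k G> = E <xi, G>] is the hypothesis on [<F, x'>] tested against
  [f (W h_1, ..., W h_n)]: the two trace pairings have the same partial sums.
  The point is additivity in [G], for which the trace series have to converge and
  their sums have to be integrable.

  Convergence: for [S] in [gamma^k(H, E)] and [x'] in the dual, the map
  [(g_1, ..., g_k) |-> x' (S g_1 ... g_k)] is multilinear and bounded, so pairing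
  [S] with an elementary tensor just evaluates this map.  The bound
  [|psi (S h)| <= C |h| ||S||_gamma] for a functional [psi] reduces to a lower
  bound for the second moment of a real Gaussian sum; no triangle inequality for the
  gamma-norm is needed, since everything is tested against functionals.

  Integrability: a measurable real function whose (lower) integral is finite is
  integrable, and finiteness is given by the single cylinder case. *)
Require Import Defs.
From mathcomp Require Import all_boot all_order all_algebra.
From mathcomp Require Import all_classical all_reals all_analysis.
From mathcomp Require Import measurable_realfun ring lra.
Import Order.TTheory GRing.Theory Num.Theory.
Import numFieldNormedType.Exports.
Local Open Scope classical_set_scope.
Local Open Scope ring_scope.

Set Implicit Arguments.
Unset Strict Implicit.
Unset Printing Implicit Defensive.

(** * Gaussian lower bound *)

(** The integral of a nonnegative function is a supremum over simple functions below it, hence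
    monotone for arbitrary functions. Integrands built from extended norms are not known to be
    measurable. *)
Lemma ge0_le_integral_nonmeasurable d (T : measurableType d) (R : realType)
    (mu : {measure set T -> \bar R}) (f g : T -> \bar R) :
  (forall t, (0 <= f t)%E) -> (forall t, (f t <= g t)%E) ->
  (\int[mu]_t f t <= \int[mu]_t g t)%E.
Proof.
move=> f0 fg; have g0 t : (0 <= g t)%E by exact: le_trans (fg t).
rewrite !ge0_integralTE//; apply: ge_ereal_sup => /= _ [h /= hf <-].
apply: ereal_sup_ubound; exists h => //= t; exact: le_trans (fg t).
Qed.

Section standard_gaussian.
Context (R : realType).
Local Notation N := (normal_prob (0 : R) 1).

(** The standard normal density is even and Lebesgue measure is invariant under reflection. *)
Lemma normal_probN (A : set R) : measurable A ->
  pushforward N (-%R : _ -> measurableTypeR R) A = N A.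
Proof.
move=> mA; rewrite /pushforward /normal_prob.
transitivity (\int[pushforward lebesgue_measure (-%R : _ -> measurableTypeR R)]_(x in A)
   (normal_pdf 0 1 x)%:E)%E; last first.
  by apply: eq_measure_integral => B mB _; exact: lebesgue_measureN.
rewrite ge0_integral_pushforward//=.
- apply: eq_integral => x _ /=; congr (_%:E).
  by rewrite normal_pdfE ?oner_eq0// /normal_fun !subr0 sqrrN.
- apply/measurable_EFinP; apply: measurable_funTS; exact: measurable_normal_pdf.
- by move=> x _; rewrite lee_fin normal_pdf_ge0.
Qed.

Lemma integral_normal_probN (f : R -> \bar R) : measurable_fun setT f ->
  (forall t, (0 <= f t)%E) -> (\int[N]_t f (- t)%R = \int[N]_t f t)%E.
Proof.
move=> mf f0; transitivity (\int[pushforward N (-%R : _ -> measurableTypeR R)]_t f t)%E.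
  by rewrite ge0_integral_pushforward.
by apply: eq_measure_integral => A mA _; exact: normal_probN.
Qed.

(** If the integral vanished, the law would be concentrated at 0, a null set by absolute
    continuity. *)
Lemma normal_second_moment_gt0 : (0 < \int[N]_t (t ^+ 2)%:E)%E.
Proof.
rewrite lt0e integral_ge0 ?andbT; last by move=> t _; rewrite lee_fin sqr_ge0.
have msq : measurable_fun setT (fun t : R => (t ^+ 2)%:E).
  by apply/measurable_EFinP; exact: measurable_funX.
apply/eqP => I0.
have /(ae_eq_integral_abs N measurableT msq) [A [mA NA0 sub]] :
    (\int[N]_t `|(t ^+ 2)%:E| = 0)%E.
  by rewrite -[RHS]I0; apply: eq_integral => t _; rewrite gee0_abs// lee_fin sqr_ge0.
have N1 : (N [set: R] = 1)%E by exact: probability_setT.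
have N0 : N [set (0 : R)] = 0%E.
  have [+ _] := null_content_dominatesP N lebesgue_measure.
  move=> /(_ (normal_prob_dominates 0 1)); apply => //; exact: lebesgue_measure_set1.
have : (N setT <= N (A `|` [set 0%R]))%E.
  apply: le_measure; rewrite ?inE//; first exact: measurableU.
  move=> t _ /=; have [->|t0] := eqVneq t 0; [by right|left].
  apply: sub => /= /(_ I) /eqP; rewrite eqe expf_eq0 /= => t0'.
  by rewrite t0' in t0.
have : (N (A `|` [set 0%R]) <= N A + N [set 0%R])%E by exact: measureU2.
by rewrite N1 NA0 N0 adde0 => le0 /le_trans/(_ le0); rewrite leNgt lte01.
Qed.

(* The minimum with 1 makes this real without showing that the second moment is
  finite (it is 1). *)
Definition gaussian_const : R := fine (mine 1 (\int[N]_t (t ^+ 2)%:E))%E.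

Lemma gaussian_constE :
  ((gaussian_const)%:E = mine 1 (\int[N]_t (t ^+ 2)%:E))%E.
Proof.
rewrite fineK// fin_numElt; apply/andP; split; last first.
  by rewrite gt_min ltry.
by rewrite lt_min ltNye_eq/= (lt_trans _ normal_second_moment_gt0)// ltNy0.
Qed.

Lemma gaussian_const_gt0 : 0 < gaussian_const.
Proof.
by rewrite -lte_fin gaussian_constE lt_min lte01 normal_second_moment_gt0.
Qed.

(* By symmetry the cross term cancels in the sum of the integrals at [a] and [- a]. *)
Lemma integral_normal_affine_sqr (a b : R) (c : R) : 0 <= c ->
  ((b ^+ 2 + gaussian_const * a ^+ 2 + c)%:E <=
   \int[N]_t ((b + a * t) ^+ 2 + c)%:E)%E.
Proof.
move=> c0.
have mfun (u v : R) : measurable_fun setT (fun t : R => ((u + v * t) ^+ 2 + c)%:E).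
  by apply/measurable_EFinP; apply: measurable_funD => //; apply: measurable_funX;
    apply: measurable_funD => //; exact: measurable_funM.
have fge0 (u v : R) (t : R) : (0 <= ((u + v * t) ^+ 2 + c)%:E)%E.
  by rewrite lee_fin addr_ge0// sqr_ge0.
set J := (\int[N]_t _)%E.
have JJ : (J + J = \int[N]_t ((2 * (b ^+ 2 + c))%:E + (2 * a ^+ 2)%:E * (t ^+ 2)%:E))%E.
  have JN : J = (\int[N]_t ((b + - a * t) ^+ 2 + c)%:E)%E.
    rewrite -[LHS]integral_normal_probN//=.
    by apply: eq_integral => t _; rewrite mulrN mulNr.
  rewrite {2}JN -ge0_integralD//; [|exact: mfun|exact: mfun].
  by apply: eq_integral => t _; rewrite -EFinM -!EFinD; congr (_%:E); ring.
have a2 : 0 <= 2 * a ^+ 2 by rewrite mulr_ge0 ?sqr_ge0.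
have H2 : ((2 * (b ^+ 2 + c))%:E + (2 * a ^+ 2)%:E * gaussian_const%:E <= J + J)%E.
  rewrite JJ ge0_integralD//=.
  - rewrite leeD//.
      by rewrite integral_cst// [X in (_ * X)%E](_ : _ = 1%E) ?mule1//;
        exact: probability_setT.
    rewrite ge0_integralZl_EFin//=.
    + rewrite lee_wpmul2l//.
      by rewrite gaussian_constE ge_min lexx orbT.
    + by move=> t _; rewrite lee_fin sqr_ge0.
    + by apply/measurable_EFinP; exact: measurable_funX.
  - by move=> t _; rewrite lee_fin mulr_ge0 ?addr_ge0 ?sqr_ge0.
  - by move=> t _; rewrite -EFinM lee_fin (mulr_ge0 a2)// sqr_ge0.
  - under eq_fun do rewrite -EFinM.
    apply/measurable_EFinP; apply: measurable_funM => //; exact: measurable_funX.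
have J0 : (0 <= J)%E by rewrite /J; apply: integral_ge0 => t _; exact: fge0.
move: H2 J0.
case: J {JJ} => [j| |]//; last by move=> _ _; rewrite leey.
by rewrite -EFinM -!EFinD !lee_fin => ? _; lra.
Qed.

(* [b] stands for the coordinates that are already integrated out. *)
Lemma gaussian_expectation_ge n (a : 'I_n -> R) (b : R) (f : seq R -> \bar R) :
  (forall s, (((b + \sum_(i < n) a i * s`_i) ^+ 2)%:E <= f s)%E) ->
  ((b ^+ 2 + gaussian_const * \sum_(i < n) a i ^+ 2)%:E <=
   gaussian_expectation n f)%E.
Proof.
have c0 := ltW gaussian_const_gt0.
elim: n a b f => [|n IH] a b f hf /=.
  by have := hf [::]; rewrite !big_ord0 mulr0 !addr0.
rewrite big_ord_recl mulrDr addrA.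
(* The contribution of the later coordinates enters as the constant [c]; the induction hypothesis is
   then used with [b + a_0 t] in place of [b]. *)
apply: le_trans (integral_normal_affine_sqr (a ord0) b _) _.
  by rewrite mulr_ge0// sumr_ge0// => i _; exact: sqr_ge0.
apply: ge0_le_integral_nonmeasurable => t.
  by rewrite lee_fin addr_ge0 ?sqr_ge0// mulr_ge0// sumr_ge0// => i _; exact: sqr_ge0.
apply: IH => s; apply: le_trans (hf _).
by rewrite big_ord_recl /= addrA.
Qed.

End standard_gaussian.

(** * Functionals on gamma^k(H, E) *)

Definition linear_form (R : realType) (X : lmodType R) (psi : X -> R) : Prop :=
  forall (a : R) (x y : X), psi (a *: x + y) = a * psi x + psi y.

Section linear_forms.
Context (R : realType) (X : lmodType R) (psi : X -> R).
Hypothesis psi_lin : linear_form psi.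

Lemma linear_form0 : psi 0 = 0.
Proof. by have := psi_lin (-1) 0 0; rewrite scaler0 addr0 mulN1r addNr. Qed.

Lemma linear_formZ a x : psi (a *: x) = a * psi x.
Proof. by rewrite -[a *: x]addr0 psi_lin linear_form0 addr0. Qed.

Lemma linear_formB x y : psi (x - y) = psi x - psi y.
Proof. by rewrite addrC -scaleN1r psi_lin mulN1r addrC. Qed.

Lemma linear_form_sum I (s : seq I) (a : I -> R) (x : I -> X) :
  psi (\sum_(i <- s) a i *: x i) = \sum_(i <- s) a i * psi (x i).
Proof.
elim: s => [|i s IH]; first by rewrite !big_nil linear_form0.
by rewrite !big_cons psi_lin IH.
Qed.

End linear_forms.

Lemma ereal_cvg_lt (R : realType) (u : nat -> \bar R) (l x : \bar R) :
  u n @[n --> \oo] --> l -> (l < x)%E -> \forall n \near \oo, (u n < x)%E.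
Proof.
move=> ul lx; apply: (ul [set z | (z < x)%E]).
by apply: open_nbhs_nbhs; split => //; exact: open_ereal_lt_ereal.
Qed.

(** The bound goes through a real majorant [r] of the norm, so it says nothing where the extended
    norm is [+oo]. *)
Definition norm_bounded (R : realType) (X : enormed R) (C : R) (psi : X -> R) :=
  linear_form psi /\
  forall (x : X) (r : R), (enorm x <= r%:E)%E -> `|psi x| <= C * r.

Lemma norm_bounded_cvg (R : realType) (X : enormed R) (C : R) (psi : X -> R)
    (x : X) (y : nat -> X) : 0 < C -> norm_bounded C psi ->
  enorm (x - y n) @[n --> \oo] --> 0%E -> psi (y n) @[n --> \oo] --> psi x.
Proof.
move=> C0 [psi_lin psi_bd] yx; apply/cvgrPdist_lt => eps eps0.
have /(ereal_cvg_lt yx) : (0%:E < (eps / (2 * C))%:E)%E.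
  by rewrite lte_fin divr_gt0 ?mulr_gt0.
apply: filterS => n /ltW/psi_bd; rewrite linear_formB// => /le_lt_trans; apply.
have -> : C * (eps / (2 * C)) = eps / 2 by field; rewrite gt_eqF.
lra.
Qed.

(** * Inner products and boundedness of a single operator slot *)

Section inner_product.
Context (R : realType) (H : completeNormedModType R) (ip : H -> H -> R).
Hypothesis Hip : inner_product ip.

Lemma ip_linl h : linear_form (ip^~ h).
Proof. by case: Hip => lin _ _ a x y; exact: lin. Qed.

Lemma ip_linr h : linear_form (ip h).
Proof. by case: Hip => lin sym _ a x y; rewrite !(sym h) lin. Qed.

Lemma ip_cauchy_schwarz x y : `|ip x y| <= `|x| * `|y|.
Proof.
have [_ sym nrm] := Hip.
have [->|y0] := eqVneq y 0.
  by rewrite linear_form0 ?normr0 ?mulr0//; exact: ip_linr.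
have y2 : 0 < `|y| ^+ 2 by rewrite exprn_gt0// normr_gt0.
(* [t *: y] is the orthogonal projection of [x] onto the line through [y]. *)
set t := ip x y / `|y| ^+ 2.
have : 0 <= ip (- t *: y + x) (- t *: y + x) by rewrite nrm sqr_ge0.
rewrite ip_linl ip_linr (ip_linr x) !nrm (sym y x).
have -> : - t * (- t * `|y| ^+ 2 + ip x y) + (- t * ip x y + `|x| ^+ 2) =
  `|x| ^+ 2 - ip x y ^+ 2 / `|y| ^+ 2.
  by rewrite /t; field; rewrite normr_eq0.
rewrite subr_ge0 ler_pdivrMr// -exprMn -[ip x y ^+ 2]real_normK ?num_real//.
by rewrite ler_pXn2r// ?nnegrE ?mulr_ge0.
Qed.

Lemma sqr_norm_orthonormal_sum n (h : 'I_n -> H) (a : 'I_n -> R) :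
  orthonormal_family ip h -> `|\sum_i a i *: h i| ^+ 2 = \sum_i a i ^+ 2.
Proof.
move=> oh; have [_ _ <-] := Hip.
rewrite (linear_form_sum (ip_linr _)); apply: eq_bigr => i _.
rewrite (linear_form_sum (ip_linl _)).
rewrite (bigD1 i)//= oh eqxx mulr1 big1 ?addr0// => j ji.
by rewrite oh (negbTE ji) mulr0.
Qed.

Definition gamma_const : R := (Num.sqrt (gaussian_const R))^-1.

Lemma gamma_const_gt0 : 0 < gamma_const.
Proof. by rewrite invr_gt0 sqrtr_gt0 gaussian_const_gt0. Qed.

Section slot.
Context (X : enormed R) (C : R) (psi : X -> R).
Hypotheses (C0 : 0 < C) (psi_bd : norm_bounded C psi).

(** For [S = sum_i h_i ⊗ x_i] one has [psi (S h) = ip v h] with [v = sum_i psi (x_i) h_i].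
    Cauchy-Schwarz leaves [|v|^2 = sum_i psi (x_i)^2], which the Gaussian lower bound controls by
    the squared gamma-norm. *)
Lemma finite_rank_bounded (S : H -> X) (rho : \bar R) (r : R) (h : H) :
  finite_rank_norm ip S rho -> (rho <= r%:E)%E ->
  `|psi (S h)| <= C * gamma_const * `|h| * r.
Proof.
move=> [n [h_ [x [oh _ -> ->]]]].
have [psi_lin psi_le] := psi_bd.
set GE := gaussian_expectation _ _.
have cGE : ((gaussian_const R * \sum_(i < n) (psi (x i) / C) ^+ 2)%:E <= GE)%E.
  rewrite -[X in (X%:E <= _)%E]add0r -[X in X + _](expr0n _ 2).
  apply: gaussian_expectation_ge => s; rewrite add0r.
  have -> : \sum_(i < n) psi (x i) / C * s`_i = psi (\sum_(i < n) s`_i *: x i) / C.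
    rewrite linear_form_sum// mulr_suml; apply: eq_bigr => i _; ring.
  (* An infinite value of [enorm], of either sign, has square [+oo]. *)
  case E : (enorm _) => [q| |]; last 2 first.
  - by rewrite expeS mulyy leey.
  - by rewrite expeS mulNyNy leey.
  have := psi_le (\sum_(i < n) s`_i *: x i) q; rewrite E lexx => /(_ isT) le_q.
  rewrite -EFin_expe lee_fin -[leLHS]real_normK ?num_real//.
  have q0 : 0 <= q by rewrite -(pmulr_rge0 _ C0) (le_trans _ le_q).
  rewrite ler_pXn2r ?nnegrE// normrM normfV (gtr0_norm C0).
  by rewrite ler_pdivrMr// mulrC.
have c0 := gaussian_const_gt0 R.
case: GE cGE => [g| |] cGE; last first.
- by rewrite leeNy_eq in cGE.
- by rewrite poweRyr ?invr_eq0// leye_eq.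
rewrite lee_fin in cGE.
have g0 : 0 <= g.
  by rewrite (le_trans _ cGE)// mulr_ge0 ?(ltW c0)// sumr_ge0// => i _; exact: sqr_ge0.
rewrite poweR_EFin lee_fin powR12_sqrt// => gr.
have r0 : 0 <= r by rewrite (le_trans _ gr)// sqrtr_ge0.
set v := \sum_i psi (x i) *: h_ i.
have -> : psi (\sum_i tensor ip (h_ i) (x i) h) = ip v h.
  rewrite (linear_form_sum psi_lin) (linear_form_sum (ip_linl h)).
  by apply: eq_bigr => i _; rewrite mulrC.
apply: le_trans (ip_cauchy_schwarz _ _) _.
rewrite [leRHS]mulrAC ler_wpM2r//.
rewrite -(ler_pXn2r (ltn0Sn 1)) ?nnegrE ?mulr_ge0 ?(ltW C0) ?(ltW gamma_const_gt0)//.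
rewrite sqr_norm_orthonormal_sum// !exprMn exprVn sqr_sqrtr ?(ltW c0)//.
have sumE : \sum_(i < n) psi (x i) ^+ 2 =
    C ^+ 2 / gaussian_const R * (gaussian_const R * \sum_(i < n) (psi (x i) / C) ^+ 2).
  rewrite mulrA divfK ?gt_eqF// mulr_sumr; apply: eq_bigr => i _.
  by field; rewrite gt_eqF.
rewrite sumE ler_wpM2l ?divr_ge0 ?sqr_ge0 ?(ltW c0)//.
rewrite (le_trans cGE)// -(sqr_sqrtr g0) ler_pXn2r ?nnegrE ?sqrtr_ge0//.
Qed.

(** The strict inequality [rho < r] makes [r] an eventual bound for the approximating norms, so the
    finite rank estimate passes to the limit. *)
Lemma gamma_limit_bounded (S : H -> X) (rho : \bar R) (r : R) (h : H) :
  gamma_limit_norm ip S rho -> (rho < r%:E)%E ->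
  `|psi (S h)| <= C * gamma_const * `|h| * r.
Proof.
move=> [S_ [r_ [fin _ S_S r_rho]]] rho_r.
have psiS : `|psi (S_ n h)| @[n --> \oo] --> `|psi (S h)|.
  by apply: cvg_norm; exact: (norm_bounded_cvg C0 psi_bd (S_S h)).
rewrite -(cvg_lim _ psiS)//; apply: limr_le; first by apply/cvg_ex; eexists; exact: psiS.
by apply: filterS (ereal_cvg_lt r_rho rho_r) => n /ltW; exact: finite_rank_bounded.
Qed.

Lemma gamma_limit_norm_ge0 (S : H -> X) (rho : \bar R) :
  gamma_limit_norm ip S rho -> (0 <= rho)%E.
Proof.
move=> [S_ [r_ [fin _ _ r_rho]]].
rewrite -(cvg_lim _ r_rho)//; apply: lime_ge; first by apply/cvg_ex; exists rho.
by apply: nearW => n; have [m [h [x [_ _ _ ->]]]] := fin n; exact: poweR_ge0.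
Qed.

(** Evaluation at [h] turns a bounded functional on [X] into one on [gamma ip X]. The factor
    [1 + |h|] keeps the constant positive at [h = 0], so that the lemma can be iterated. *)
Lemma gamma_bounded (h : H) :
  norm_bounded (X := gamma ip X) (C * (gamma_const * (1 + `|h|)))
    (fun S => psi (S h)).
Proof.
have [psi_lin _] := psi_bd; split=> [a S S'|S r Sr]; first exact: psi_lin.
have K0 := gamma_const_gt0.
have r0 : 0 <= r.
  rewrite -lee_fin (le_trans _ Sr)//; apply: le_ereal_inf_tmp => rho /=.
  exact: gamma_limit_norm_ge0.
apply/ler_addgt0Pr => eps eps0.
have D0 : 0 < C * gamma_const * (1 + `|h|).
  by rewrite !mulr_gt0// ltr_pwDl.
(* The norm is an infimum; this slack costs exactly [eps] after multiplication by the constant. *)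
have : (enorm S < (r + eps / (C * gamma_const * (1 + `|h|)))%:E)%E.
  by rewrite (le_lt_trans Sr)// lte_fin ltrDl divr_gt0.
move=> /ereal_inf_lt [rho /= Srho rho_lt].
apply: le_trans (gamma_limit_bounded h Srho rho_lt) _.
apply: (@le_trans _ _ (C * gamma_const * (1 + `|h|) *
    (r + eps / (C * gamma_const * (1 + `|h|))))).
  rewrite ler_wpM2r ?addr_ge0 ?divr_ge0 ?(ltW eps0) ?(ltW D0)//.
  by rewrite ler_wpM2l ?mulr_ge0 ?(ltW C0) ?(ltW K0)// lerDr.
by rewrite mulrDr mulrA [X in _ + X]mulrC divfK ?gt_eqF.
Qed.

End slot.

(** * Evaluation in all slots and multilinearity *)

(** Only the first [k] entries of the infinite sequence are read; dropping the first argument is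
    then a shift. *)
Fixpoint evalN (X : enormed R) k : gammaN ip k X -> (nat -> H) -> X :=
  match k with
  | 0 => fun x _ => x
  | k'.+1 => fun S g => evalN (S (g 0%N)) (fun i => g i.+1)
  end.

Section multilinear.
Context (X : enormed R) (C : R) (psi : X -> R).
Hypotheses (C0 : 0 < C) (psi_bd : norm_bounded C psi).

Definition evalN_const k (g : nat -> H) : R :=
  C * \prod_(i < k) (gamma_const * (1 + `|g i|)).

Lemma evalN_const_gt0 k g : 0 < evalN_const k g.
Proof.
rewrite mulr_gt0// prodr_gt0// => i _.
by rewrite mulr_gt0 ?gamma_const_gt0// ltr_pwDl.
Qed.

Lemma evalN_bounded k (g : nat -> H) :
  norm_bounded (X := gammaN ip k X) (evalN_const k g) (fun S => psi (evalN S g)).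
Proof.
elim: k g => [|k IH] g /=; first by rewrite /evalN_const big_ord0 mulr1.
have := gamma_bounded (evalN_const_gt0 k (fun i => g i.+1))
  (IH (fun i => g i.+1)) (g 0%N).
by congr norm_bounded; rewrite /evalN_const big_ord_recl mulrAC mulrA.
Qed.

(** Linearity in each slot separately, after testing against [psi]: the second conjunct concerns the
    outermost slot, the recursion the inner ones. *)
Fixpoint multilinear k : gammaN ip k X -> Prop :=
  match k with
  | 0 => fun=> True
  | k'.+1 => fun S => (forall h, multilinear (S h)) /\
      forall g, linear_form (fun h => psi (evalN (S h) g))
  end.

Lemma multilinearD k a (S S' : gammaN ip k X) :
  multilinear S -> multilinear S' -> multilinear (a *: S + S').
Proof.
elim: k S S' => [//|k IH] S S' [S1 S2] [S1' S2']; split=> [h|g b x y].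
  exact: (IH (S h) (S' h) (S1 h) (S1' h)).
have [lin _] := evalN_bounded k g.
transitivity (a * psi (evalN (S (b *: x + y)) g) + psi (evalN (S' (b *: x + y)) g)).
  exact: lin.
rewrite S2 S2'.
have lin' z : psi (evalN ((a *: S + S') z) g) =
  a * psi (evalN (S z) g) + psi (evalN (S' z) g) by exact: lin.
rewrite !lin'; ring.
Qed.

Lemma multilinear0 k : multilinear (0 : gammaN ip k X).
Proof.
elim: k => [//|k IH]; split=> [h|g b x y]; first exact: IH.
have [lin _] := evalN_bounded k g.
have z0 z : psi (evalN ((0 : gammaN ip k.+1 X) z) g) = 0.
  exact: (linear_form0 lin).
by rewrite !z0 mulr0 addr0.
Qed.

Lemma multilinear_lim k (S : gammaN ip k X) (S_ : nat -> gammaN ip k X) :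
  (forall n, multilinear (S_ n)) ->
  (forall g, psi (evalN (S_ n) g) @[n --> \oo] --> psi (evalN S g)) ->
  multilinear S.
Proof.
elim: k S S_ => [//|k IH] S S_ mS cS; split=> [h|g b x y].
  apply: (IH _ (fun n => S_ n h)) => [n|g]; first exact: (mS n).1.
  (* Convergence for [k.+1] slots is used at the sequence [g] with [h] put in front. *)
  exact: (cS (fun i => if i is i'.+1 then g i' else h)).
have cS' z : psi (evalN (S_ n z) g) @[n --> \oo] --> psi (evalN (S z) g).
  exact: (cS (fun i => if i is i'.+1 then g i' else z)).
have c2 : psi (evalN (S_ n (b *: x + y)) g) @[n --> \oo] -->
    b * psi (evalN (S x) g) + psi (evalN (S y) g).
  have -> : (fun n => psi (evalN (S_ n (b *: x + y)) g)) =
      (fun n => b * psi (evalN (S_ n x) g) + psi (evalN (S_ n y) g)).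
    by apply/funext => n; exact: (mS n).2.
  by apply: cvgD; [apply: cvgMr; exact: cS'|exact: cS'].
exact: (cvg_unique _ (cS' _) c2).
Qed.

(* Tested against [psi], [S] is a pointwise limit of finite rank operators. *)
Lemma multilinear_bspace k (S : gammaN ip k X) :
  bspace (gammaN ip k X) S -> multilinear S.
Proof.
elim: k S => [//|k IH] S /ereal_inf_lt [rho /= [S_ [r_ [fin _ S_S _]]] _].
have cS h g : psi (evalN (S_ n h) g) @[n --> \oo] --> psi (evalN (S h) g).
  exact: (norm_bounded_cvg (evalN_const_gt0 k g) (evalN_bounded k g) (S_S h)).
apply: (@multilinear_lim k.+1 S S_) => [n|g]; last exact: cS.
have [m [h_ [x [_ x_b -> _]]]] := fin n; split=> [h|g a y z].
  (* For fixed [h] the value is a combination of the [x i], which are multilinear by induction. *)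
  elim/big_ind : _ => [|u v mu mv|i _]; first exact: multilinear0.
    by rewrite -[u]scale1r; exact: multilinearD.
  rewrite -[tensor _ _ _ _]addr0; apply: multilinearD; first exact/IH/x_b.
  exact: multilinear0.
have [lin _] := evalN_bounded k g.
rewrite !(linear_form_sum lin) mulr_sumr -big_split; apply: eq_bigr => i _.
by rewrite (ip_linr (h_ i)) /= mulrDl mulrA.
Qed.

End multilinear.
End inner_product.

(** * Trace pairing with elementary tensors *)

Lemma topdual_norm_bounded (R : realType) (E : normedModType R) (x' : topdual E) :
  bspace (topdual E) x' ->
  exists2 C : R, 0 < C & norm_bounded (X := of_normed E) C (x' : of_normed E -> R).
Proof.
move=> /ereal_inf_lt [_ /= [M [M0 [lin bd]] <-] _].
(* [M] may be 0, and a positive constant is wanted. *)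
exists (M + 1); first by rewrite ltr_wpDl.
split=> [//|x r]; rewrite /= lee_fin => xr; apply: le_trans (bd x) _.
by rewrite ler_pM// lerDl.
Qed.

Section trace.
Context (R : realType) (H : completeNormedModType R) (ip : H -> H -> R).
Hypothesis Hip : inner_product ip.
Context (e : nat -> H) (He : orthonormal_basis ip e) (E : normedModType R).

Fixpoint tensorN (X : enormed R) k (g : nat -> H) (u : X) : gammaN ip k X :=
  match k with
  | 0 => u
  | k'.+1 => tensor ip (g 0%N) (tensorN k' (fun i => g i.+1) u)
  end.

(* The factors [1 + `|g i|], rather than [`|g i|], keep all constants positive. *)
Definition weakly_bounded k (x' : topdual E) (S : gammaN ip k (of_normed E)) :=
  exists M : R, forall g : nat -> H,
    `|x' (evalN S g)| <= M * \prod_(i < k) (1 + `|g i|).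

(** This is what the convergence of the trace series uses of [S]. It passes at once to the values
    [S h], as the induction on [k] requires. *)
Definition regular k (S : gammaN ip k (of_normed E)) : Prop :=
  forall x' : topdual E, bspace (topdual E) x' ->
    multilinear (X := of_normed E) x' S /\ weakly_bounded x' S.

Lemma regular_bspace k (S : gammaN ip k (of_normed E)) :
  bspace (gammaN ip k (of_normed E)) S -> regular S.
Proof.
move=> bS x' /topdual_norm_bounded [C C0 x'_bd]; split.
  exact: (multilinear_bspace Hip C0 x'_bd bS).
have [r Sr] : exists r : R, (enorm S <= r%:E)%E.
  move: bS; rewrite /bspace /=; case: (enorm S) => [r _|//|_]; first by exists r.
  (* The type of [enorm] formally allows [-oo]. *)
  by exists 0; rewrite leNye.
exists (C * gamma_const R ^+ k * r) => g.
have [_ /(_ _ _ Sr) /le_trans] := evalN_bounded Hip C0 x'_bd k g; apply.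
rewrite /evalN_const big_split/= prodr_const card_ord le_eqVlt.
by apply/orP; left; apply/eqP; ring.
Qed.

Lemma regular_app k (S : gammaN ip k.+1 (of_normed E)) h : regular S ->
  regular (S h : gammaN ip k (of_normed E)).
Proof.
move=> rS x' bx'; have [[mS _] [M SM]] := rS x' bx'; split; first exact: mS.
exists (M * (1 + `|h|)) => g.
have := SM (fun i => if i is i'.+1 then g i' else h).
by rewrite big_ord_recl /= mulrA.
Qed.

(** [phi] is continuous, so it may be applied term by term to the expansion of [h] in the basis. *)
Lemma orthonormal_expansion_cvg (phi : H -> R) (M : R) (h : H) :
  linear_form phi -> (forall x, `|phi x| <= M * (1 + `|x|)) ->
  \sum_(i < n) ip h (e i) * phi (e i) @[n --> \oo] --> phi h.
Proof.
move=> lin bd; have [_ _ eh] := He; have [_ sym _] := Hip.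
have M0 : 0 <= M.
  by rewrite (le_trans (normr_ge0 (phi 0)))// (le_trans (bd 0))// normr0 addr0 mulr1.
(* Scaling to unit vectors, where [1 + |x| = 2], turns the affine bound into a linear one. *)
have bd2 x : `|phi x| <= 2 * M * `|x|.
  have [->|x0] := eqVneq x 0; first by rewrite (linear_form0 lin) !normr0 mulr0.
  have nx : 0 < `|x| by rewrite normr_gt0.
  have := bd (`|x|^-1 *: x).
  rewrite (linear_formZ lin) normrM normrZ normfV normr_id mulVf ?gt_eqF//.
  by rewrite mulrC ler_pdivrMr// => /le_trans; apply; rewrite -mulrA mulrCA; lra.
apply/cvgrPdist_lt => eps eps0.
have d0 : 0 < eps / (2 * M + 1) by rewrite divr_gt0// ltr_wpDl// mulr_ge0.
have /cvgrPdist_lt/(_ _ d0) := eh h; apply: filterS => n.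
have -> : \sum_(i < n) ip h (e i) * phi (e i) = phi (\sum_(i < n) ip (e i) h *: e i).
  by rewrite (linear_form_sum lin); apply: eq_bigr => i _; rewrite sym.
rewrite -(linear_formB lin) => hn; apply: le_lt_trans (bd2 _) _.
rewrite ltr_pdivlMr in hn; last by rewrite ltr_wpDl// mulr_ge0.
by apply: le_lt_trans hn; rewrite mulrC ler_wpM2l// lerDl.
Qed.

Lemma cvg_seq_sum (I : Type) (P : I -> Prop) (s : seq I) (u : I -> nat -> R) (l : I -> R) :
  (forall i, P i -> u i n @[n --> \oo] --> l i) -> List.Forall P s ->
  \sum_(i <- s) u i n @[n --> \oo] --> \sum_(i <- s) l i.
Proof.
move=> ul; elim=> [|i {}s Pi _ IH].
  by rewrite big_nil; under eq_fun do rewrite big_nil; exact: cvg_cst.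
rewrite big_cons; under eq_fun do rewrite big_cons.
by apply: cvgD => //; exact: ul.
Qed.

(** For an elementary tensor the outermost trace series is the expansion of the first argument [g_0]
    in the basis, so its sum is evaluation at [g_0]. The coefficients [c] are general because the
    induction absorbs inner products into them. *)
Lemma trace_pairing_tensorN I (s : seq I) k (S : gammaN ip k (of_normed E))
    (c : I -> R) (g : I -> nat -> H) (x' : I -> topdual E) :
  regular S -> List.Forall (fun i => bspace (topdual E) (x' i)) s ->
  trace_pairing e S (\sum_(i <- s) c i *: tensorN k (g i) (x' i)) =
  \sum_(i <- s) c i * x' i (evalN S (g i)).
Proof.
elim: k S c g => [|k IH] S c g rS bs.
  rewrite /=; elim: s {bs} => [|i s IHs]; first by rewrite !big_nil.
  by rewrite !big_cons -IHs.
have pw (t : seq I) h : (\sum_(i <- t) c i *: tensorN k.+1 (g i) (x' i)) h =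
    \sum_(i <- t) (c i * ip (g i 0%N) h) *: tensorN k (fun m => g i m.+1) (x' i).
  elim: t => [|i t IHt]; first by rewrite !big_nil.
  by rewrite !big_cons -IHt -scalerA.
have E1 n : \sum_(j < n) trace_pairing e (S (e j))
    ((\sum_(i <- s) c i *: tensorN k.+1 (g i) (x' i)) (e j)) =
  \sum_(i <- s) c i * \sum_(j < n) ip (g i 0%N) (e j) *
     x' i (evalN (S (e j)) (fun m => g i m.+1)).
  transitivity (\sum_(j < n) \sum_(i <- s) (c i * ip (g i 0%N) (e j)) *
     x' i (evalN (S (e j)) (fun m => g i m.+1))).
    apply: eq_bigr => j _; rewrite -IH//; last exact: regular_app.
    by congr trace_pairing; exact: pw.
  rewrite exchange_big; apply: eq_bigr => i _; rewrite mulr_sumr.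
  by apply: eq_bigr => j _; rewrite mulrA.
transitivity (limn (fun n => \sum_(i <- s) c i * \sum_(j < n) ip (g i 0%N) (e j) *
     x' i (evalN (S (e j)) (fun m => g i m.+1)))).
  by rewrite /=; congr (limn _); apply/funext => n; exact: E1.
apply: cvg_lim => //; apply: (cvg_seq_sum _ bs) => i bx'.
apply: cvgMr; have [[_ lin] [M SM]] := rS _ bx'.
(* The factors of the bound that belong to the fixed inner arguments go into the constant. *)
apply: (@orthonormal_expansion_cvg (fun h => x' i (evalN (S h) (fun m => g i m.+1)))
  (M * \prod_(j < k) (1 + `|g i j.+1|))) => [|x]; first exact: lin.
have := SM (fun j => if j is j'.+1 then g i j'.+1 else x).
by rewrite big_ord_recl /= -mulrA [X in M * X]mulrC.
Qed.

End trace.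

(** * Measurability *)

Section measurability.
Context d (T : measurableType d) (R : realType).

(** Here [f] is arbitrary: the rounded vector takes values in the countable set of integer vectors,
    and each level set is a finite intersection of preimages of intervals. *)
Lemma measurable_discretized n (X : 'I_n -> T -> R) (m : nat)
    (f : 'rV[int]_n -> R) : (forall i, measurable_fun setT (X i)) ->
  measurable_fun setT (fun w => f (\row_i Num.floor (X i w * m.+1%:R))).
Proof.
move=> mX _ B _; rewrite setTI.
set Q := fun w : T => \row_i Num.floor (X i w * m.+1%:R).
have -> : (fun w => f (Q w)) @^-1` B =
    \bigcup_(v in setT) (if f v \in B then Q @^-1` [set v] else set0).
  apply/seteqP; split=> [w /= Bw|w [v _]].
    by exists (Q w) => //; rewrite mem_set.
  by case: ifPn => //; rewrite inE => Bv /= Qw; rewrite /= Qw.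
apply: countable_bigcupT_measurable; first exact: countableP.
move=> v; case: ifP => _; last exact: measurable0.
have -> : Q @^-1` [set v] =
    \bigcap_(i in [set: 'I_n]) ((fun w => X i w * m.+1%:R) @^-1`
       `[(v 0 i)%:~R, (v 0 i + 1)%:~R[%classic).
  apply/seteqP; split=> [w /= Qw i _|w /= Qw].
    by rewrite /= in_itv/= -floor_eq -Qw mxE.
  apply/rowP => i; rewrite mxE; apply/eqP; rewrite floor_eq.
  by have := Qw i I; rewrite /= in_itv.
apply: fin_bigcap_measurable => [|i _]; first exact: finite_finset.
rewrite -[X in measurable X]setTI.
by apply: measurable_funM => //; exact: measurable_itv.
Qed.

(* Rounding the coordinates down to multiples of 1/(m+1) turns [f] into a function
  of countably many values. *)
Lemma measurable_continuous_rV n (X : 'I_n -> T -> R) (f : 'rV[R]_n -> R^o) :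
  (forall i, measurable_fun setT (X i)) -> continuous f ->
  measurable_fun setT (fun w => f (\row_i X i w) : R).
Proof.
move=> mX cf.
pose q (m : nat) (v : 'rV[int]_n) : 'rV[R]_n := \row_i ((v 0 i)%:~R / m.+1%:R).
apply: (@measurable_fun_cvg _ _ _ setT
  (fun m w => f (q m (\row_i Num.floor (X i w * m.+1%:R))))) => [m|w _].
  exact: (measurable_discretized m (fun v => f (q m v))).
have qX : q m (\row_i Num.floor (X i w * m.+1%:R)) @[m --> \oo] --> \row_i X i w.
  apply/cvg_ballP => eps eps0.
  apply: filterS (near_infty_natSinv_lt (PosNum eps0)) => m /= m_eps.
  split=> // i j; rewrite !mxE /ball /=; apply: le_lt_trans m_eps.
  have /andP[fl fu] := floor_itv (X j w * m.+1%:R).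
  have m0 : 0 < m.+1%:R :> R by rewrite ltr0n.
  rewrite -[X in X - _](mulfK (lt0r_neq0 m0)) -mulrBl normrM normfV (gtr0_norm m0).
  rewrite ler_pdivrMr// mulVf ?gt_eqF// ger0_norm ?subr_ge0//.
  by rewrite lerBlDl ltW// -[1]/(1%:~R) -intrD.
exact: (@cvg_comp _ _ _ _ f _ _ _ qX (cf _)).
Qed.

(** The approximating simple functions become real simple functions under [psi], and these converge
    pointwise. *)
Lemma measurable_norm_bounded (X : enormed R) (C : R) (psi : X -> R) (f : T -> X) :
  0 < C -> norm_bounded C psi -> strongly_measurable measurable f ->
  measurable_fun setT (fun w => psi (f w)).
Proof.
move=> C0 psi_bd [s s_in s_f].
apply: (@measurable_fun_cvg _ _ _ setT (fun n w => psi (sf_eval (s n) w))) => [n|w _].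
  have [psi_lin _] := psi_bd.
  under eq_fun do rewrite (linear_form_sum psi_lin).
  apply: measurable_sum => i; apply: measurable_funM => //.
  by apply: measurable_indic; have [] := s_in n i.
exact: (norm_bounded_cvg C0 psi_bd (s_f w)).
Qed.

End measurability.

(** * Iterated Malliavin derivatives *)

Lemma Cb_infty_partial (R : realType) n (i : 'I_n) (f : 'rV[R]_n -> R^o) :
  Cb_infty f -> Cb_infty (partial i f).
Proof. by move=> Cf s; rewrite -foldr_rcons; exact: Cf. Qed.

Section malliavin.
Context (R : realType) (H : completeNormedModType R) (ip : H -> H -> R).
Context d (T : measurableType d) (P : probability T R).
Context (W : H -> {RV P >-> R}).

(** The value is kept in factored form, as an element of [X] with its list of directions, so that
    the trace formula for elementary tensors applies. *)
Definition tensor_cylinder (X : enormed R) k (c : cylinder H X * (nat -> H)) :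
    cylinder H (gammaN ip k X) :=
  Cylinder (cyl_fun c.1) (cyl_dir c.1) (tensorN ip k c.2 (cyl_val c.1)).

(** Each derivative replaces the function by a partial derivative and adds one tensor factor to the
    value. *)
Lemma malliavin_Dk_tensor (X : enormed R) k (G : seq (cylinder H X)) :
  smooth G -> exists2 L : seq (cylinder H X * (nat -> H)),
    List.Forall (fun c => cyl_smooth c.1) L &
    malliavin_Dk ip k G = [seq tensor_cylinder k c | c <- L].
Proof.
elim: k => [|k IH] sG.
  (* For [k = 0] no direction is read, so the zero sequence is a dummy. *)
  exists [seq (g, fun=> 0) | g <- G]; last by elim: G {sG} => [//|[n f h x] G /= <-].
  by elim: sG => [|g {}G sg _ IHG]; constructor.
have [L sL /= ->] := IH sG.
elim: sL => [|[g h] {}L [/= sf sv] _ [L' sL' eL']]; first by exists [::]; constructor.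
exists ([seq (Cylinder (partial i (cyl_fun g)) (cyl_dir g) (cyl_val g),
    (* The new direction becomes the outermost slot. *)
    fun m => if m is m'.+1 then h m' else cyl_dir g i) | i <- enum 'I_(cyl_size g)]
    ++ L').
  apply/List.Forall_app; split=> //.
  elim: (enum _) => [|i s IHs]; constructor => //.
  by split=> //; exact: Cb_infty_partial.
by rewrite map_cat -eL' -map_comp.
Qed.

Lemma malliavin_Dk_cat (X : enormed R) k (G1 G2 : seq (cylinder H X)) :
  malliavin_Dk ip k (G1 ++ G2) = malliavin_Dk ip k G1 ++ malliavin_Dk ip k G2.
Proof.
by elim: k => [//|k IH] /=; rewrite IH /malliavin_D map_cat flatten_cat.
Qed.

(** * Transfer from scalar to dual-valued test variables *)

Section lift.
Context (E : normedModType R) (x' : topdual E).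

(** Composition with [x'] in the innermost slot: the adjoint of [pairing x'] for the trace
    pairing. *)
Fixpoint liftN k : gammaN ip k (topdual R^o) -> gammaN ip k (topdual E) :=
  match k with
  | 0 => fun u x => u (x' x)
  | k'.+1 => fun U h => liftN (U h)
  end.

Lemma liftN_lin k a (U V : gammaN ip k (topdual R^o)) :
  liftN (a *: U + V) = a *: liftN U + liftN V.
Proof.
elim: k U V => [//|k IH] U V; apply/funext => h; exact: (IH (U h) (V h)).
Qed.

Lemma liftN0 k : liftN (0 : gammaN ip k (topdual R^o)) = 0.
Proof. by elim: k => [//|k IH]; apply/funext => h; exact: IH. Qed.

Lemma liftNZ k a (U : gammaN ip k (topdual R^o)) :
  liftN (a *: U) = a *: liftN U.
Proof. by rewrite -[a *: U]addr0 liftN_lin liftN0 addr0. Qed.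

Definition lift_cylinder k (c : cylinder H (gammaN ip k (topdual R^o))) :
    cylinder H (gammaN ip k (topdual E)) :=
  Cylinder (cyl_fun c) (cyl_dir c) (liftN (cyl_val c)).

Lemma malliavin_Dk_lift k (G : seq (cylinder H (topdual R^o))) :
  malliavin_Dk ip k [seq @lift_cylinder 0 g | g <- G] =
  [seq @lift_cylinder k g | g <- malliavin_Dk ip k G].
Proof.
elim: k => [//|k /= ->]; rewrite /malliavin_D map_flatten -!map_comp.
congr flatten; apply: eq_map => g /=; rewrite /cyl_D -map_comp.
apply: eq_map => i /=; congr Cylinder; apply/funext => h.
by rewrite /= liftNZ.
Qed.

Lemma smooth_eval_lift k (G : seq (cylinder H (gammaN ip k (topdual R^o)))) w :
  smooth_eval W [seq lift_cylinder g | g <- G] w = liftN (smooth_eval W G w).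
Proof.
rewrite /smooth_eval; elim: G => [|g G IH]; first by rewrite !big_nil liftN0.
by rewrite !big_cons IH liftN_lin.
Qed.

(** At every level both limits are taken of the same sequence of partial sums. *)
Lemma trace_pairing_lift (e : nat -> H) k (S : gammaN ip k (of_normed E))
    (U : gammaN ip k (topdual R^o)) :
  trace_pairing e S (liftN U) =
  trace_pairing e (pairing x' S : gammaN ip k (of_normed R^o)) U.
Proof.
elim: k S U => [//|k IH] S U /=; congr (limn _); apply/funext => n.
by apply: eq_bigr => i _; exact: IH.
Qed.

End lift.
End malliavin.

(** * Divergence *)

(** The identity is the number 1 in the dual of the scalars: a scalar variable [f] is tested as
    [f ⊗ id]. *)
Lemma bspace_topdual_id (R : realType) :
  bspace (topdual R^o) (id : topdual R^o).
Proof.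
apply: (@le_lt_trans _ _ 1%:E); last exact: ltry.
apply: ereal_inf_lbound; exists 1 => //; split=> //; split=> // x.
by rewrite mul1r.
Qed.

Section divergence.
Context (R : realType) (H : completeNormedModType R) (ip : H -> H -> R).
Hypothesis Hip : inner_product ip.
Context (e : nat -> H) (He : orthonormal_basis ip e).
Context d (T : measurableType d) (P : probability T R).
Context (W : H -> {RV P >-> R}) (E : completeNormedModType R).
Context (k : nat) (F : T -> gammaN ip k (of_normed E)).
Hypotheses (F_bspace : forall w, bspace (gammaN ip k (of_normed E)) (F w))
  (F_meas : strongly_measurable measurable F).
Context (xi : T -> of_normed E).
Hypothesis xi_meas : strongly_measurable measurable xi.
Hypothesis F_div : forall x' : topdual E, bspace (topdual E) x' ->
  is_divergence W e (E := R^o) 1 (fun w => pairing x' (F w)) (fun w => x' (xi w)).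

Let trF (G : seq (cylinder H (topdual E))) w : R :=
  trace_pairing e (F w) (smooth_eval W (malliavin_Dk ip k G) w).

Let smooth_tensor_sum (L : seq (cylinder H (topdual E) * (nat -> H))) w :
  smooth_eval W [seq tensor_cylinder ip k c | c <- L] w =
  \sum_(c <- L) cyl_fun c.1 (\row_i W (cyl_dir c.1 i) w) *:
     tensorN ip k c.2 (cyl_val c.1).
Proof. by rewrite /smooth_eval big_map. Qed.

(** Replacing the iterated limits by a finite sum gives access to measurability and additivity. *)
Let trF_sum G (L : seq (cylinder H (topdual E) * (nat -> H))) w :
  List.Forall (fun c => cyl_smooth c.1) L ->
  malliavin_Dk ip k G = [seq tensor_cylinder ip k c | c <- L] ->
  trF G w = \sum_(c <- L) cyl_fun c.1 (\row_i W (cyl_dir c.1 i) w) *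
     cyl_val c.1 (evalN (F w) c.2).
Proof.
move=> sL GL; rewrite /trF GL smooth_tensor_sum (trace_pairing_tensorN Hip He)//.
  exact: regular_bspace.
by apply: List.Forall_impl sL => c [].
Qed.

Let measurable_cyl_fun (c : cylinder H (topdual E)) : cyl_smooth c ->
  measurable_fun setT (fun w => cyl_fun c (\row_i W (cyl_dir c i) w) : R).
Proof.
move=> [Cf _]; apply: (@measurable_continuous_rV _ _ _ _ (fun i => W (cyl_dir c i))).
  by move=> i; exact: measurable_funPT.
by have [] := Cf [::].
Qed.

Let measurable_trF G : smooth G -> measurable_fun setT (trF G).
Proof.
move=> /(malliavin_Dk_tensor ip k) [L sL GL].
have -> : trF G = fun w => \sum_(c <- L) cyl_fun c.1 (\row_i W (cyl_dir c.1 i) w) *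
    cyl_val c.1 (evalN (F w) c.2) by apply/funext => w; exact: trF_sum.
move: GL => _.
elim: sL => [|c {}L sc sL IH].
  by under eq_fun do rewrite big_nil; exact: measurable_cst.
under eq_fun do rewrite big_cons; apply: measurable_funD => //.
apply: measurable_funM; first exact: measurable_cyl_fun.
have [C C0 bd] := topdual_norm_bounded sc.2.
apply: (measurable_norm_bounded _ (evalN_bounded Hip C0 bd k c.2) F_meas).
exact: evalN_const_gt0.
Qed.

(** Additivity of [limn] requires convergence; here all three terms are finite sums, and the
    representing lists are concatenated. *)
Let trF_cons g G w : smooth (g :: G) -> trF (g :: G) w = trF [:: g] w + trF G w.
Proof.
move=> sgG; have [sg sG] := (List.Forall_inv sgG, List.Forall_inv_tail sgG).
have [L1 sL1 GL1] := malliavin_Dk_tensor ip k (List.Forall_cons g sg (List.Forall_nil _)).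
have [L2 sL2 GL2] := malliavin_Dk_tensor ip k sG.
rewrite (trF_sum w sL1 GL1) (trF_sum w sL2 GL2) -big_cat; apply: trF_sum.
  exact/List.Forall_app.
by rewrite map_cat -GL1 -GL2 -malliavin_Dk_cat.
Qed.

Let smooth_xi (G : seq (cylinder H (topdual E))) w : R := smooth_eval W G w (xi w).

Let smooth_xi_cons g G w : smooth_xi (g :: G) w = smooth_xi [:: g] w + smooth_xi G w.
Proof. by rewrite /smooth_xi /smooth_eval !big_cons big_nil addr0. Qed.

Let smooth_xi1 (g : cylinder H (topdual E)) w : smooth_xi [:: g] w =
  cyl_fun g (\row_i W (cyl_dir g i) w) * cyl_val g (xi w).
Proof. by rewrite /smooth_xi /smooth_eval big_cons big_nil addr0. Qed.

Let integrable_smooth_xi1 (g : cylinder H (topdual E)) : cyl_smooth g ->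
  P.-integrable setT (fun w => (smooth_xi [:: g] w)%:E).
Proof.
move=> sg; have [_ _ [M Mf]] := sg.1 [::].
have [C C0 bd] := topdual_norm_bounded sg.2.
have mxi : measurable_fun setT (fun w => cyl_val g (xi w) : R).
  exact: (measurable_norm_bounded C0 bd xi_meas).
(* Integrability of [x' (xi)] is part of the scalar divergence hypothesis; the cylinder function is
   bounded by [M]. *)
have [[_ _ xi1] _] := F_div sg.2.
apply: (@le_integrable _ _ _ _ _ measurableT _
    (fun w => M%:E * (`|cyl_val g (xi w)|)%:E)%E).
- apply/measurable_EFinP; rewrite (_ : smooth_xi _ = fun w =>
      cyl_fun g (\row_i W (cyl_dir g i) w) * cyl_val g (xi w)); last first.
    by apply/funext => w; exact: smooth_xi1.
  by apply: measurable_funM => //; exact: measurable_cyl_fun.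
- move=> w _; rewrite smooth_xi1 -EFinM /= lee_fin normrM [leRHS]ger0_norm.
    by apply: ler_wpM2r => //; exact: Mf.
  by rewrite mulr_ge0// (le_trans _ (Mf 0)).
apply: integrableZl => //.
apply/integrableP; split.
  by apply/measurable_EFinP; exact: measurableT_comp.
by move: xi1; rewrite /Lp_norm Lnorm1.
Qed.

(** The scalar hypothesis for [x' = cyl_val g] is tested with the scalar cylinder [g'], whose lift
    along [x'] is [g]. *)
Let trF1 (g : cylinder H (topdual E)) : cyl_smooth g ->
  (\int[P]_w (trF [:: g] w)%:E = \int[P]_w (smooth_xi [:: g] w)%:E)%E.
Proof.
move=> sg; have [_ div] := F_div sg.2.
pose g' : cylinder H (topdual R^o) :=
  Cylinder (cyl_fun g) (cyl_dir g) (id : topdual R^o).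
have sg' : smooth [:: g'].
  by constructor => //; split; [exact: sg.1|exact: bspace_topdual_id].
have := div _ sg'; rewrite unlock.
have -> : smooth_xi [:: g] = fun w => smooth_eval W [:: g'] w (cyl_val g (xi w)).
  by apply/funext => w; rewrite smooth_xi1 /smooth_eval big_cons big_nil addr0.
move=> <-; apply: eq_integral => w _; congr (_%:E).
rewrite -trace_pairing_lift -smooth_eval_lift -malliavin_Dk_lift /trF.
by have -> : [seq @lift_cylinder _ _ ip _ (cyl_val g) 0 c | c <- [:: g']] = [:: g]
  by rewrite /g'; clear; case: g.
Qed.

Lemma is_divergence_smooth (G : seq (cylinder H (topdual E))) : smooth G ->
  ('E_P[fun w => trace_pairing e (F w) (smooth_eval W (malliavin_Dk ip k G) w)] =
   'E_P[fun w => smooth_eval W G w (xi w)])%E.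
Proof.
rewrite unlock => sG.
(* Integrability of both sides is carried through the induction on [G], since it is what makes the
   integrals additive. *)
suff [_ _ ->] : [/\ P.-integrable setT (EFin \o trF G),
    P.-integrable setT (EFin \o smooth_xi G) &
    (\int[P]_w (trF G w)%:E = \int[P]_w (smooth_xi G w)%:E)%E] by [].
elim: G sG => [|g G IH] sgG.
  have trF0 : trF [::] = fun=> 0.
    apply/funext => w; rewrite (@trF_sum [::] [::])//; first by rewrite big_nil.
    by elim: (k) => [//|k' /= ->].
  have xi0 : smooth_xi [::] = fun=> 0.
    by apply/funext => w; rewrite /smooth_xi /smooth_eval big_nil.
  by rewrite trF0 xi0; split => //; exact: integrable0.
have [sg sG] := (List.Forall_inv sgG, List.Forall_inv_tail sgG).
have {IH} [iF ixi eG] := IH sG.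
have ixi1 := integrable_smooth_xi1 sg.
have iF1 : P.-integrable setT (EFin \o trF [:: g]).
  have mF1 : measurable_fun setT (trF [:: g]).
    by apply: measurable_trF; constructor.
  apply/integrableP; split; first exact/measurable_EFinP.
  (* the integral is finite by [trF1], and for real-valued measurable functions this
    already means integrability *)
  rewrite integral_fin_num_abs// trF1//; exact: integrable_fin_num.
have -> : EFin \o trF (g :: G) = (EFin \o trF [:: g]) \+ (EFin \o trF G).
  by apply/funext => w; rewrite /= trF_cons.
have -> : EFin \o smooth_xi (g :: G) = (EFin \o smooth_xi [:: g]) \+ (EFin \o smooth_xi G).
  by apply/funext => w; rewrite /= smooth_xi_cons.
split; [exact: integrableD|exact: integrableD|].
under eq_integral do rewrite trF_cons// EFinD.
under [RHS]eq_integral do rewrite smooth_xi_cons// EFinD.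
by rewrite !integralD// trF1// eG.
Qed.

End divergence.

Unset Implicit Arguments.

Theorem theorem4p7 (R : realType)
  (H : completeNormedModType R) (ip : H -> H -> R)
  (Hip : inner_product ip) (Hsep : separable H)
  (e : nat -> H) (He : orthonormal_basis ip e)
  (d : measure_display) (T : measurableType d) (P : probability T R)
  (W : H -> {RV P >-> R}) (HW : isonormal ip W) (Wgen : generated_by W)
  (E : completeNormedModType R) (E_UMD : UMD E)
  (p : R) (p_gt1 : 1 < p) (k : nat) (k_ge1 : (1 <= k)%N)
  (F : T -> gammaN ip k (of_normed E)) (F_Lp : Lp P p F)
  (F_dom : forall x' : topdual E, bspace (topdual E) x' ->
    divergence_domain W e (E := R^o) 1 (fun w => pairing x' (F w)))
  (xi : T -> of_normed E) (xi_Lp : Lp P p xi)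
  (F_div : forall x' : topdual E, bspace (topdual E) x' ->
    is_divergence W e (E := R^o) 1 (fun w => pairing x' (F w))
      (fun w => x' (xi w))) :
  divergence_domain W e p F /\ is_divergence W e p F xi.
Proof.
have [F_bspace F_meas _] := F_Lp; have [_ xi_meas _] := xi_Lp.
have divF : is_divergence W e p F xi.
  split=> // G; exact: (is_divergence_smooth Hip He F_bspace F_meas xi_meas F_div).
by split=> //; split=> //; exists xi.
Qed.
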